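(* For every positive integer $k$, there exists a graph $G$ of treewidth $k$ with $\mathrm{diam}(\mathcal{I}(G)) = 2k$.
   Context: Graphs are finite and simple. An orientation of $G$ assigns a direction to each edge of $G$. Given an orientation $\overrightarrow{G_1}$ of $G$ and a subset $X\subseteq V(G)$, the inversion of $X$ on $\overrightarrow{G_1}$ is the operation that reverses the direction of all arcs with both end-vertices in $X$, which results in another orientation of $G$. The inversion graph $\mathcal{I}(G)$ is the graph whose vertices are the orientations of $G$, two orientations $\overrightarrow{G_1},\overrightarrow{G_2}$ being adjacent if and only if there is an inversion of some $X\subseteq V(G)$ transforming $\overrightarrow{G_1}$ into $\overrightarrow{G_2}$. The inversion diameter of $G$ is the diameter $\mathrm{diam}(\mathcal{I}(G))$ of this graph. Treewidth is the usual notion; equivalently, $G$ has treewidth at most $k$ if and only if $G$ is a subgraph of a $k$-tree, where a graph is a $k$-tree if it is a $k$-clique or it has a vertex $v$ such that $N(v)$ is a $k$-clique and $G-v$ is a $k$-tree. *)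

(* Defs.v *)
From HB Require Import structures.
From mathcomp Require Import all_boot.

Set Implicit Arguments.
Unset Strict Implicit.
Unset Printing Implicit Defensive.

Record sgraph := SGraph {
  vertex :> finType;
  edge : rel vertex;
  edge_sym : symmetric edge;
  edge_irr : irreflexive edge }.

Definition walk (G : sgraph) (x y : G) (p : seq G) : Prop :=
  path (@edge G) x p /\ last x p = y.

Definition is_dist (G : sgraph) (x y : G) (d : nat) : Prop :=
  (exists2 p : seq G, walk x y p & size p = d) /\
  (forall p : seq G, walk x y p -> d <= size p).

(* A disconnected graph has no (finite) diameter in this sense. *)
Definition is_diam (G : sgraph) (d : nat) : Prop :=
  (forall x y : G, exists2 n, is_dist x y n & n <= d) /\
  (exists x y : G, is_dist x y d).

Definition is_tree (I : sgraph) : Prop :=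
  [/\ 0 < #|I|,
      forall i j : I, connect (@edge I) i j
    & forall c : seq I, 2 < size c -> ~ ucycle (@edge I) c].

Record tree_decomposition (G : sgraph) := TreeDecomposition {
  td_tree : sgraph;
  td_bag : td_tree -> {set G};
  td_treeP : is_tree td_tree;
  td_vertex : forall x : G, exists i, x \in td_bag i;
  td_edge : forall x y : G, edge x y ->
    exists i, (x \in td_bag i) && (y \in td_bag i);
  td_connected : forall (x : G) (i j : td_tree),
    x \in td_bag i -> x \in td_bag j ->
    connect [rel u v | [&& edge u v, x \in td_bag u & x \in td_bag v]] i j }.

Definition max_bag (G : sgraph) (D : tree_decomposition G) : nat :=
  \max_(i : td_tree D) #|td_bag i|.

(* The width of a decomposition is [max_bag D - 1]; stating this with [k.+1]
   avoids truncated subtraction (the empty graph, of treewidth -1, has no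
   treewidth in nat). *)
Definition is_treewidth (G : sgraph) (k : nat) : Prop :=
  (exists D : tree_decomposition G, max_bag D = k.+1) /\
  (forall D : tree_decomposition G, k.+1 <= max_bag D).

(* [(x, y) \in A] means that the edge xy is directed from x to y. *)
Definition is_orientation (G : sgraph) (A : {set G * G}) : bool :=
  [forall x : G, forall y : G,
     if edge x y then ((x, y) \in A) (+) ((y, x) \in A)
     else (x, y) \notin A].

Definition orientation (G : sgraph) : finType :=
  {A : {set G * G} | is_orientation A}.

Definition invert (G : sgraph) (X : {set G}) (A : {set G * G}) : {set G * G} :=
  [set a | if (a.1 \in X) && (a.2 \in X) then (a.2, a.1) \in A else a \in A].

Lemma invertK (G : sgraph) (X : {set G}) : involutive (invert X).
Proof.
by move=> A; apply/setP=> -[x y]; rewrite !inE /= andbC; case: ifP=> // ->.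
Qed.

Lemma invert_orientation (G : sgraph) (X : {set G}) (A : {set G * G}) :
  is_orientation A -> is_orientation (invert X A).
Proof.
move/forallP=> hA; apply/forallP=> x; apply/forallP=> y.
have /forallP/(_ y) := hA x; have /forallP/(_ x) := hA y.
rewrite !inE /= edge_sym [(y \in X) && _]andbC.
by case: ifP => _; case: ifP => // _; rewrite addbC.
Qed.

(* Inverting a set that spans no edge fixes the orientation; distinctness only
   discards these loops, which do not affect distances. *)
Definition inversion_adj (G : sgraph) : rel (orientation G) :=
  fun A B => (A != B) && [exists X : {set G}, val B == invert X (val A)].

Lemma inversion_adj_sym (G : sgraph) : symmetric (@inversion_adj G).
Proof.
move=> A B; rewrite /inversion_adj eq_sym; congr andb.
by apply/existsP/existsP=> -[X /eqP h]; exists X; rewrite h invertK.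
Qed.

Lemma inversion_adj_irr (G : sgraph) : irreflexive (@inversion_adj G).
Proof. by move=> A; rewrite /inversion_adj eqxx. Qed.

Definition inversion_graph (G : sgraph) : sgraph :=
  SGraph (@inversion_adj_sym G) (@inversion_adj_irr G).

(* Main.v *)
(* Two orientations are at distance at most n in the inversion graph iff vectors
   u_x in F_2^n can be chosen at the vertices so that, for every edge xy, u_x.u_y
   tells whether the orientations disagree on xy.

   The graph is a k-tree, properly coloured with k+1 colours, obtained by
   repeatedly picking, in every (k+1)-clique, a colour whose vertex is replaced by
   a new one; there is one new vertex for each colour and each prescription of its
   dot products with the other k vertices.

   In dimension 2k every prescription can be met while keeping any k vectors of a
   clique independent: the solutions for the new vector form an affine space with
   2^k elements, and only the 2^k - 1 sums of proper subfamilies of the k old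
   vectors are forbidden.

   In dimension 2k-1, let W be the span of k vectors of a clique. They must be
   independent, so W^perp has dimension k-1. If their Gram matrix is a a^T, then
   a <> 0 and W^perp is contained in W; prescribing 0 or a according to the parity
   of a, every solution for the next vector is a sum of a proper subfamily of the
   k vectors, which yields k dependent vectors in a clique. Such a Gram matrix can
   be forced: keep a set Z of vectors and a set O of vectors whose dot products
   are 1 inside O and 0 elsewhere (self products included), and ask for a vector v
   with products 1 with O and 0 with Z. If v.v = 1, it joins O; if v.v = 0, it
   joins Z, and O is emptied. Either way (|Z|, |O|) increases
   lexicographically. *)
Require Import Defs.
From mathcomp Require Import all_boot all_algebra.
From mathcomp Require Import zify.

Set Implicit Arguments.
Unset Strict Implicit.
Unset Printing Implicit Defensive.

Import GRing.Theory.

(** * Cliques in tree decompositions *)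

Section Trees.
Variable I : sgraph.
Hypothesis treeI : is_tree I.

(** A simple path from [j] to [i] avoiding the edge between them would close up with it to a cycle
    of length at least 3. *)
Lemma tree_edge_cut (i j : I) : edge i j ->
  ~~ connect [rel u v | [&& edge u v, (u, v) != (i, j) & (u, v) != (j, i)]] j i.
Proof.
have [_ _ acyclic] := treeI; move=> eij; apply/negP=> /connectP[p hp lp].
case/shortenP: hp lp => p' hp' up' _ lp.
have hp : path (@edge I) j p'.
  by apply: sub_path hp' => u v /and3P[].
case: p' hp' up' lp hp => [|a [|b p']] hp' up' lp hp.
- by move: eij; rewrite lp edge_irr.
- by move: hp'; rewrite /= in lp *; rewrite -lp eqxx !andbF.
- apply: (acyclic (j :: a :: b :: p')) => //; rewrite /ucycle up' andbT.
  by rewrite /cycle rcons_path hp -lp.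
Qed.

Definition avoiding (i : I) : rel I := [rel u v | [&& edge u v, u != i & v != i]].

Lemma avoiding_sym i : connect_sym (avoiding i).
Proof.
by apply: sym_connect_sym => u v; rewrite /avoiding /= edge_sym [(u != i) && _]andbC.
Qed.

(** Neither walk uses the edge [ij]; joined at [t], they would connect [j] to [i] without it. *)
Lemma tree_no_both_sides (i j t : I) : edge i j ->
  connect (avoiding i) j t -> connect (avoiding j) i t -> False.
Proof.
move=> eij jt; rewrite avoiding_sym => ti.
have /negP := tree_edge_cut eij; apply.
suff sub a : (a == i) || (a == j) -> subrel (connect (avoiding a))
    (connect [rel u v | [&& edge u v, (u, v) != (i, j) & (u, v) != (j, i)]]).
  by apply: connect_trans (sub _ _ _ _ jt) (sub _ _ _ _ ti); rewrite eqxx ?orbT.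
move=> aij; apply: connect_sub => u v /= /and3P[euv ua va]; apply: connect1 => /=.
rewrite euv /= !xpair_eqE; case/orP: aij ua va => /eqP -> /negbTE -> /negbTE ->;
  by rewrite ?andbF.
Qed.

(** Iterating [f] ends in a cycle of the graph, whose length can be neither above 2 in a tree nor 1
    without loops. *)
Lemma edge_fun_backtracks (f : I -> I) : (forall i, edge i (f i)) ->
  exists i, f (f i) = i.
Proof.
have [I0 _ acyclic] := treeI; move=> ef; case/card_gt0P: I0 => i0 _.
have /trajectP[m ltm fm] := looping_order f i0.
pose x := iter m f i0.
have xK : exists n, iter n.+1 f x = x.
  by exists (order f i0 - m).-1; rewrite prednK ?subn_gt0 // -iterD subnK // ltnW.
have fcyc : fcycle f (orbit f x) by apply/(orbitPcycle 0 3).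
have ecyc : cycle (@edge I) (orbit f x).
  by apply: sub_cycle fcyc => u v /= /eqP <-.
have [s2|] := ltnP 2 (size (orbit f x)).
  by case: (acyclic _ s2); rewrite /ucycle ecyc orbit_uniq.
have /(orbitPcycle 3 4) := xK; rewrite size_orbit.
case: (order f x) (order_gt0 f x) => [|[|[|//]]] //= _ fx _; last by exists x.
by have := ef x; rewrite fx edge_irr.
Qed.

Lemma tree_step (i t : I) : i != t ->
  exists2 j, edge i j & connect (avoiding i) j t.
Proof.
have [_ conn _] := treeI; move=> it.
have /connectP[p hp lp] := conn i t; case/shortenP: hp lp => -[|j p'] //=.
  by move=> _ _ _ eit; rewrite eit eqxx in it.
move=> /andP[eij hp'] /andP[ip' _] _ lp; exists j => //.
apply/connectP; exists p' => //; apply: (sub_in_path (P := predC1 i)) hp'.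
  by move=> u v /= ui vi euv; apply/and3P; split.
by apply/allP=> u; apply: contraTneq => ->.
Qed.
End Trees.

(* If no bag contains C, step from each node towards the bags of a vertex of C
   missing from it. In a tree these steps backtrack along some edge, which
   separates the bags of two vertices of C. *)
Lemma clique_bag (G : sgraph) (D : tree_decomposition G) (C : {set G}) :
  {in C &, forall x y, x != y -> edge x y} -> exists i : td_tree D, C \subset td_bag i.
Proof.
move=> cliqueC; apply/existsP; apply: contraT; rewrite negb_exists => /forallP noC.
pose T := td_tree D.
pose step (i j : T) := [exists x in C, (x \notin td_bag i) &&
  [exists t, (x \in td_bag t) && connect (avoiding i) j t]].
have exf (i : T) : exists j, edge i j && step i j.
  have /subsetPn[x xC xi] := noC i; have [t xt] := td_vertex D x.
  have it : i != t by apply: contraNneq xi => ->.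
  have [j eij jt] := tree_step (td_treeP D) it.
  exists j; rewrite eij; apply/existsP; exists x; rewrite xC xi.
  by apply/existsP; exists t; rewrite xt.
pose f i := xchoose (exf i).
have ef i : edge i (f i) by have /andP[] := xchooseP (exf i).
(* The nodes whose bags contain [x] are connected and miss [i], so they all lie on the same side as
   [f i]. *)
have reach i : exists2 x, x \in C & forall s, x \in td_bag s -> connect (avoiding i) (f i) s.
  have /andP[_ /existsP[x /and3P[xC xi /existsP[t /andP[xt jt]]]]] := xchooseP (exf i).
  exists x => // s xs; apply: connect_trans jt _.
  have sub : subrel [rel u v | [&& edge u v, x \in td_bag u & x \in td_bag v]] (avoiding i).
    move=> u v /= /and3P[euv xu xv]; rewrite /avoiding /= euv /=.
    by apply/andP; split; apply/eqP => ei; rewrite ei (negbTE xi) in xu xv.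
  exact: connect_sub (fun u v uv => connect1 (sub u v uv)) _ _ (td_connected xt xs).
have [i fi] := edge_fun_backtracks (td_treeP D) ef.
have [x xC hx] := reach i; have [y yC hy] := reach (f i).
have [s xs ys] : exists2 s : T, x \in td_bag s & y \in td_bag s.
  have [xy|/(cliqueC _ _ xC yC)/(td_edge D)[s /andP[]]] := eqVneq x y; last by exists s.
  by have [s xs] := td_vertex D x; exists s; rewrite -?xy.
have := hy _ ys; rewrite fi => iy.
by case: (tree_no_both_sides (td_treeP D) (ef i) (hx _ xs) iy).
Qed.

(** * Inversion distance and vector assignments *)

Local Open Scope ring_scope.

Definition dot n (u v : 'rV['F_2]_n) : 'F_2 := (u *m v^T) 0 0.

Lemma dotE n (u v : 'rV['F_2]_n) : dot u v = \sum_j u 0 j * v 0 j.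
Proof. by rewrite /dot mxE; apply: eq_bigr => j _; rewrite mxE. Qed.

Lemma dotC n (u v : 'rV['F_2]_n) : dot u v = dot v u.
Proof. by rewrite !dotE; apply: eq_bigr => j _; rewrite mulrC. Qed.

Lemma dot_sumr n (I : finType) (P : pred I) (x : I -> 'F_2)
    (B : I -> 'rV['F_2]_n) v :
  dot v (\sum_(i | P i) x i *: B i) = \sum_(i | P i) x i * dot v (B i).
Proof.
rewrite /dot linear_sum mulmx_sumr summxE; apply: eq_bigr => i _.
by rewrite linearZ -scalemxAr mxE.
Qed.

Lemma F2_cases (x : 'F_2) : x = 0 \/ x = 1.
Proof. by case: x => -[|[|m]] hm //; [left | right]; apply: val_inj. Qed.

Lemma F2_eqb (x : 'F_2) : x = ((x != 0) : nat)%:R.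
Proof. by case: (F2_cases x) => ->. Qed.

Lemma F2_addb (a b : bool) : ((a (+) b) : nat)%:R = (a : nat)%:R + (b : nat)%:R :> 'F_2.
Proof. by case: a b => -[] //; apply: val_inj. Qed.

Lemma F2_inj (a b : bool) : (a : nat)%:R = (b : nat)%:R :> 'F_2 -> a = b.
Proof. by case: a b => -[]. Qed.

Lemma F2_odd n : ((odd n) : nat)%:R = n%:R :> 'F_2.
Proof. by elim: n => // n IH; rewrite oddS -addTb F2_addb IH -mulrS. Qed.

Section Inversions.
Variable G : sgraph.
Implicit Types (A B : orientation G) (x y : G).

Definition invert_all (S : {set G * G}) (Xs : seq {set G}) :=
  foldl (fun T X => invert X T) S Xs.

Lemma orientation_edge A x y :
  edge x y -> ((y, x) \in val A) = ~~ ((x, y) \in val A).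
Proof.
move=> exy; have /forallP/(_ x)/forallP/(_ y) := valP A.
by rewrite exy; case: (_ \in _); case: (_ \in _).
Qed.

Lemma orientation_nonedge A x y : ~~ edge x y -> (x, y) \in val A = false.
Proof.
move=> /negbTE exy; have /forallP/(_ x)/forallP/(_ y) := valP A.
by rewrite exy => /negbTE.
Qed.

Definition inverted (X : {set G}) A : orientation G :=
  Sub (invert X (val A)) (invert_orientation X (valP A)).

Lemma mem_inverted X A x y : edge x y ->
  ((x, y) \in val (inverted X A)) = ((x, y) \in val A) (+) ((x \in X) && (y \in X)).
Proof.
move=> exy; rewrite SubK inE /=.
by case: ifP => _; rewrite ?addbF // orientation_edge // addbT.
Qed.

Lemma invert_all_orientation A Xs : is_orientation (invert_all (val A) Xs).
Proof.
rewrite /invert_all; elim: Xs (val A) (valP A) => //= X Xs IH S hS.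
exact/IH/invert_orientation.
Qed.

Lemma mem_invert_all A Xs x y : edge x y ->
  ((x, y) \in invert_all (val A) Xs) =
  ((x, y) \in val A) (+) odd (count (fun X : {set G} => (x \in X) && (y \in X)) Xs).
Proof.
move=> exy; elim: Xs A => [|X Xs IH] A /=; first by rewrite addbF.
rewrite (IH (inverted X A)) /=.
by rewrite mem_inverted // oddD oddb addbA.
Qed.

Lemma walk_invert_all A B p : @walk (inversion_graph G) A B p ->
  exists2 Xs, size Xs = size p & val B = invert_all (val A) Xs.
Proof.
case; elim: p A => [|C p IH] A /=; first by move=> _ ->; exists [::].
move=> /andP[/andP[_ /existsP[X /eqP hX]] hp] /(IH _ hp)[Xs sz ->].
by exists (X :: Xs); rewrite /= ?sz // -hX.
Qed.

(** Inversions that change nothing are not edges and are skipped, hence only an inequality. *)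
Lemma invert_all_walk A B Xs : val B = invert_all (val A) Xs ->
  exists2 p, @walk (inversion_graph G) A B p & (size p <= size Xs)%N.
Proof.
elim: Xs A => [|X Xs IH] A /= hB.
  by exists [::] => //; split=> //=; apply/val_inj.
pose C := inverted X A; have [p [hp lp] sp] := IH C hB.
have [eqC|neC] := eqVneq A C; first by exists p; [rewrite eqC | apply: leqW].
exists (C :: p) => //; split=> //=; rewrite hp andbT /inversion_adj neC.
by apply/existsP; exists X.
Qed.

Definition realizes n (lab : G -> G -> bool) (U : G -> 'rV['F_2]_n) :=
  forall x y, edge x y -> dot (U x) (U y) = (lab x y : nat)%:R.

Definition disagree A B x y := ((x, y) \in val A) (+) ((x, y) \in val B).

(** The dot product counts, modulo 2, the sets containing both ends, that is, how often an edge [xy]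
    is reversed. *)
Lemma dot_indicator n (X : 'I_n -> {set G}) x y :
  dot (\row_j (x \in X j : nat)%:R) (\row_j (y \in X j : nat)%:R) =
  (odd (count (fun Y : {set G} => (x \in Y) && (y \in Y)) [seq X j | j : 'I_n]) : nat)%:R.
Proof.
rewrite count_map F2_odd -sum1_count natr_sum big_mkcond big_enum dotE /=.
by apply: eq_bigr => j _; rewrite !mxE -natrM mulnb; case: ifP.
Qed.

Lemma walk_realizes A B p : @walk (inversion_graph G) A B p ->
  exists U : G -> 'rV['F_2]_(size p), realizes (disagree A B) U.
Proof.
move/walk_invert_all=> [Xs sz hB].
pose X (j : 'I_(size p)) := nth set0 Xs j.
have XsE : Xs = [seq X j | j : 'I_(size p)].
  apply: (@eq_from_nth _ set0) => [|i hi]; first by rewrite size_map size_enum_ord.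
  have hi' : (i < size p)%N by rewrite -sz.
  by rewrite (nth_map (Ordinal hi')) ?size_enum_ord // /X nth_enum_ord.
exists (fun x => \row_j (x \in X j : nat)%:R) => x y exy.
rewrite dot_indicator -XsE; congr ((_ : bool) : nat)%:R.
by rewrite /disagree hB mem_invert_all // addKb.
Qed.

Lemma realizes_walk n A B (U : G -> 'rV['F_2]_n) : realizes (disagree A B) U ->
  exists2 p, @walk (inversion_graph G) A B p & (size p <= n)%N.
Proof.
move=> hU; pose X (j : 'I_n) := [set x | U x 0 j != 0].
have UE x : U x = \row_j (x \in X j : nat)%:R.
  by apply/rowP=> j; rewrite !mxE inE -F2_eqb.
have hB : val B = invert_all (val A) [seq X j | j : 'I_n].
  apply/setP=> -[x y]; have [exy|nexy] := boolP (edge x y).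
    rewrite mem_invert_all //; have := hU _ _ exy.
    rewrite !UE dot_indicator => /F2_inj ->.
    by rewrite /disagree addKb.
  pose C : orientation G := Sub _ (invert_all_orientation A [seq X j | j : 'I_n]).
  by rewrite (orientation_nonedge B) // (orientation_nonedge C).
have [p hp] := invert_all_walk hB; rewrite size_map size_enum_ord => sp.
by exists p.
Qed.

Lemma walk_dist (H : sgraph) (x y : H) p :
  walk x y p -> exists2 d, is_dist x y d & (d <= size p)%N.
Proof.
move=> [hp lp].
pose Q n := [exists t : n.-tuple H, path (@edge H) x t && (last x t == y)].
have exQ : exists n, Q n.
  by exists (size p); apply/existsP; exists (in_tuple p); rewrite hp lp /=.
have minQ q : walk x y q -> (ex_minn exQ <= size q)%N.
  case: ex_minnP => m _ mmin [hq lq]; apply: mmin.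
  by apply/existsP; exists (in_tuple q); rewrite hq lq /=.
exists (ex_minn exQ); last exact: minQ.
split=> //; case: ex_minnP => m /existsP[t /andP[ht /eqP lt]] _.
by exists t; rewrite ?size_tuple.
Qed.

Lemma orientation_pair (lab : G -> G -> bool) :
  (forall x y, lab x y = lab y x) ->
  exists A B, forall x y, edge x y -> disagree A B x y = lab x y.
Proof.
move=> labC; pose r x y := (enum_rank x < enum_rank y)%N.
have oA : is_orientation [set a : G * G | edge a.1 a.2 && r a.1 a.2].
  apply/forallP=> x; apply/forallP=> y; rewrite !inE /= (edge_sym y) /r.
  have [exy|//] := boolP (edge x y).
  have : enum_rank x != enum_rank y.
    by apply: contraTneq exy => /enum_rank_inj ->; rewrite edge_irr.
  by rewrite -(inj_eq val_inj) /=; case: ltngtP.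
have oB : is_orientation [set a : G * G | edge a.1 a.2 && (r a.1 a.2 (+) lab a.1 a.2)].
  apply/forallP=> x; apply/forallP=> y; rewrite !inE /= (edge_sym y) labC /r.
  have [exy|//] := boolP (edge x y).
  have : enum_rank x != enum_rank y.
    by apply: contraTneq exy => /enum_rank_inj ->; rewrite edge_irr.
  by rewrite -(inj_eq val_inj) /=; case: ltngtP; case: (lab y x).
exists (Sub _ oA), (Sub _ oB) => x y exy.
by rewrite /disagree !inE /= exy /= addKb.
Qed.

Lemma realizes_widen m n (lab : G -> G -> bool) (U : G -> 'rV['F_2]_m) :
  (m <= n)%N -> realizes lab U -> exists V : G -> 'rV['F_2]_n, realizes lab V.
Proof.
move=> lemn hU; rewrite -(subnKC lemn).
exists (fun x => row_mx (U x) 0) => x y exy.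
by rewrite /dot tr_row_mx mul_row_col mul0mx addr0 -hU.
Qed.

(** Every symmetric labelling is the disagreement of two orientations, and zero coordinates can be
    appended, so failure in dimension [n] excludes all distances up to [n]. *)
Lemma diam_realizes n :
  (forall lab, (forall x y, lab x y = lab y x) ->
     exists U : G -> 'rV['F_2]_n.+1, realizes lab U) ->
  (exists2 lab, (forall x y, lab x y = lab y x) &
     forall U : G -> 'rV['F_2]_n, ~ realizes lab U) ->
  is_diam (inversion_graph G) n.+1.
Proof.
move=> hup [lab labC hlab].
have dist_le (A B : inversion_graph G) : exists2 d, is_dist A B d & (d <= n.+1)%N.
  pose lab' x y := edge x y && disagree A B x y.
  have lab'C x y : lab' x y = lab' y x.
    rewrite /lab' (edge_sym y); have [exy|//] := boolP (edge x y).
    by rewrite /disagree !(orientation_edge _ exy) addbN addNb negbK.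
  have [U hU] := hup lab' lab'C.
  have {}hU : realizes (disagree A B) U by move=> x y exy; rewrite hU // /lab' exy.
  have [p hp sp] := realizes_walk hU.
  by have [d hd dp] := walk_dist hp; exists d => //; apply: leq_trans sp.
split=> //; have [A [B AB]] := orientation_pair labC.
exists A, B; have [d hd dn] := dist_le A B.
suff nd : ~~ (d <= n)%N.
  rewrite -ltnNge in nd; rewrite -[n.+1](_ : d = _) //.
  by apply/eqP; rewrite eqn_leq dn.
apply/negP=> led; have [[p hp sp] _] := hd.
have [U hU] := walk_realizes hp.
have {}hU : realizes lab U by move=> x y exy; rewrite hU // AB.
by rewrite -sp in led; have [V /hlab] := realizes_widen led hU.
Qed.

End Inversions.

(** * Families of vectors over F_2 *)

Section Families.
Variables (k n : nat).
Implicit Types (B : 'I_k.+1 -> 'rV['F_2]_n) (p w : 'I_k.+1) (v : 'rV['F_2]_n).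

Definition replace B w v : 'I_k.+1 -> 'rV['F_2]_n :=
  fun i => if i == w then v else B i.

Definition others w B : 'M['F_2]_(k, n) := \matrix_i B (lift w i).

Definition generic B := [forall w, row_free (others w B)].

Lemma replace_same B w v : replace B w v w = v.
Proof. by rewrite /replace eqxx. Qed.

Lemma replace_other B w v i : i != w -> replace B w v i = B i.
Proof. by rewrite /replace => /negbTE ->. Qed.

Lemma others_replace w B v : others w (replace B w v) = others w B.
Proof.
by apply/row_matrixP=> i; rewrite !rowK replace_other // eq_sym neq_lift.
Qed.

Lemma sum_others w B (x : 'I_k.+1 -> 'F_2) :
  \sum_i x i *: B i = x w *: B w + (\row_j x (lift w j)) *m others w B.
Proof.
rewrite (bigD1_ord w) //= mulmx_sum_row; congr (_ + _).
by apply: eq_bigr => i _; rewrite mxE rowK.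
Qed.

(** Some [k] of the vectors are dependent exactly when the whole family has a nontrivial relation
    with a zero coefficient. Over F_2, the only nontrivial relation left is the one with all
    coefficients 1. *)
Lemma genericP B :
  reflect (forall (x : 'I_k.+1 -> 'F_2) w,
             x w = 0 -> \sum_i x i *: B i = 0 -> forall i, x i = 0)
          (generic B).
Proof.
apply: (iffP forallP) => [free x w xw|gB w].
  rewrite (sum_others w) xw scale0r add0r -(mul0mx _ (others w B)) => Bx i.
  have [-> //|iw] := eqVneq i w.
  have [j -> _] : {j | i = lift w j & unlift w i = Some j}.
    by apply: unlift_some; rewrite eq_sym.
  by have /rowP/(_ j) := row_free_inj (free w) Bx; rewrite !mxE.
apply: inj_row_free => v vB.
pose x i := if unlift w i is Some j then v 0 j else 0.
have xE : \row_j x (lift w j) = v by apply/rowP=> j; rewrite mxE /x liftK.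
have xw : x w = 0 by rewrite /x unlift_none.
have x0 : forall i, x i = 0.
  by apply: (gB x w) => //; rewrite (sum_others w) xE vB xw scale0r addr0.
by rewrite -xE; apply/rowP=> j; rewrite !mxE.
Qed.

Lemma dot_others w B v (c : 'I_k.+1 -> 'F_2) :
  (forall i, i != w -> dot v (B i) = c i) <->
  v *m (others w B)^T = \row_j c (lift w j).
Proof.
have dE j : (v *m (others w B)^T) 0 j = dot v (B (lift w j)).
  by rewrite dotE mxE; apply: eq_bigr => l _; rewrite !mxE.
split=> [h|/rowP h i iw].
  by apply/rowP=> j; rewrite dE h ?mxE // eq_sym neq_lift.
have [j -> _]: {j | i = lift w j & unlift w i = Some j}.
  by apply: unlift_some; rewrite eq_sym.
by rewrite -dE h mxE.
Qed.

(** A game of [m] rounds: the opponent names a colour and prescribes products, the player must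
    replace the vector of that colour accordingly. *)
Fixpoint survives m B : Prop :=
  if m is m'.+1 then
    forall w (c : 'I_k.+1 -> 'F_2), exists2 v,
      forall i, i != w -> dot v (B i) = c i & survives m' (replace B w v)
  else True.

Lemma survives_le m m' B : (m' <= m)%N -> survives m B -> survives m' B.
Proof.
elim: m' m B => [//|m' IH] [//|m] B /= le hB w c.
by have [v hv sv] := hB w c; exists v => //; apply: IH sv.
Qed.

(** Against a relation that is zero at [w] but not at [i], ask for product 1 with [B i] and 0 with
    the rest: the answer would have product [x i] with the zero vector. *)
Lemma survives_generic m B : survives m.+1 B -> generic B.
Proof.
move=> /= hB; apply/genericP => x w xw Bx i; apply/eqP; apply/negPn/negP=> xi.
have [v hv _] := hB w (fun j => (j == i : nat)%:R).
have : dot v (\sum_j x j *: B j) = x i.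
  rewrite dot_sumr (bigD1 i) //= hv ?eqxx ?mulr1; last first.
    by apply: contraNneq xi => ->; rewrite xw.
  rewrite big1 ?addr0 // => j ji; have [->|jw] := eqVneq j w; first by rewrite xw mul0r.
  by rewrite hv // (negbTE ji) mulr0.
rewrite Bx /dot trmx0 mulmx0 mxE => x0.
by rewrite -x0 eqxx in xi.
Qed.

Lemma F2_addrr (V : lmodType 'F_2) (x : V) : x + x = 0.
Proof.
by rewrite -mulr2n -scaler_nat (_ : 2%:R = 0) ?scale0r //; apply: val_inj.
Qed.

Lemma ones_or_zero m (x : 'rV['F_2]_m) :
  x <> const_mx 1 -> exists i, x 0 i = 0.
Proof.
move=> nx; have [/existsP[i /eqP xi]|] := boolP [exists i, x 0 i == 0].
  by exists i.
rewrite negb_exists => /forallP h; case: nx; apply/rowP=> i; rewrite mxE.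
by have := h i; case: (F2_cases (x 0 i)) => ->.
Qed.

(** The first round asks for [v]; the second guarantees that the family containing [v] is
    generic. *)
Lemma survives_rank1_absurd B p (a : 'I_k.+1 -> 'F_2) : n.+1 = (2 * k)%N ->
  survives 2 B ->
  (forall i j, i != p -> j != p -> dot (B i) (B j) = a i * a j) -> False.
Proof.
move=> nk hB gram; have gB := survives_generic hB.
set U := others p B; pose a' : 'cV['F_2]_k := \col_j a (lift p j).
have Ufree : row_free U by apply: (forallP gB).
have UU : U *m U^T = a' *m a'^T.
  apply/matrixP=> i j; rewrite [RHS]mxE big_ord1 !mxE -gram ?(eq_sym _ p) ?neq_lift //.
  by rewrite dotE; apply: eq_bigr => l _; rewrite !mxE.
(* [kermx U^T] is the orthogonal of the row space of [U], of dimension n - k = k - 1. *)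
have rU : \rank (kermx U^T) = k.-1.
  by rewrite mxrank_ker mxrank_tr (eqP Ufree); lia.
have sub : (kermx a' *m U <= kermx U^T)%MS.
  by apply/sub_kermxP; rewrite -mulmxA UU mulmxA mulmx_ker mul0mx.
have ra : \rank (kermx a' *m U) = (k - \rank a')%N by rewrite mxrankMfree ?mxrank_ker.
(* Comparing dimensions in [sub] shows that [a'] is nonzero, and then that the inclusion is an
   equality. *)
have ra1 : \rank a' = 1%N.
  have := mxrankS sub; rewrite ra rU; have := rank_leq_col a'; lia.
have sup : (kermx U^T <= kermx a' *m U)%MS.
  by rewrite -(mxrank_leqif_sup sub) ra rU ra1 subn1.
(* The all-ones row has product [s + 1] with [a'], so any row with product [s] has a zero
   coefficient. *)
pose s : 'F_2 := ((const_mx 1 : 'rV_k) *m a') 0 0 + 1.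
have /submxP[x0 hx0] : (s%:M <= a')%MS by apply: submx_full; rewrite -col_leq_rank ra1.
have [v /dot_others hv sv] := hB p (fun i => s * a i).
have /submxP[D hD] : (v - x0 *m U <= kermx a' *m U)%MS.
  apply: submx_trans sup; apply/sub_kermxP.
  rewrite mulmxBl hv -mulmxA UU mulmxA -hx0 mul_scalar_mx; apply/rowP=> j.
  by rewrite !mxE subrr.
pose x := x0 + D *m kermx a'.
have vE : v = x *m U by rewrite mulmxDl -(mulmxA D) -hD addrC subrK.
have xa : (x *m a') 0 0 = s.
  by rewrite mulmxDl -(mulmxA D) mulmx_ker mulmx0 addr0 -hx0 mxE eqxx mulr1n.
have [i0 xi0] : exists i, x 0 i = 0.
  apply: ones_or_zero => x1; move/eqP: xa; rewrite /s -x1.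
  by rewrite -subr_eq0 opprD addNKr oppr_eq0 oner_eq0.
(* The coefficients of the relation v + x U = 0, which vanish at [lift p i0]. *)
pose y i := if unlift p i is Some j then x 0 j else 1.
suff : y p = 0 by move/eqP; rewrite /y unlift_none oner_eq0.
have /genericP gB' := survives_generic (m := 0) sv.
apply: (gB' y (lift p i0)); first by rewrite /y liftK.
rewrite (sum_others p) others_replace replace_same {1}/y unlift_none scale1r.
rewrite (_ : \row_j y (lift p j) = x) -?vE ?F2_addrr //.
by apply/rowP=> j; rewrite mxE /y liftK.
Qed.

Lemma generic_extend B w (c : 'I_k.+1 -> 'F_2) : n = (2 * k)%N -> generic B ->
  exists v, (forall i, i != w -> dot v (B i) = c i) /\ generic (replace B w v).
Proof.
move=> nk gB; set U := others w B.
have Ufree : row_free U by apply: (forallP gB).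
have /submxP[v0 hv0] : (\row_j c (lift w j) <= U^T)%MS.
  by apply: submx_full; rewrite -col_leq_rank mxrank_tr (eqP Ufree).
set K := row_base (kermx U^T).
have rK : \rank (kermx U^T) = k.
  by rewrite mxrank_ker mxrank_tr (eqP Ufree); lia.
pose good := [set v0 + y *m K | y : 'rV_(\rank (kermx U^T))].
(* Only sums of proper subfamilies are excluded: the sum of all [k] vectors yields a relation
   without zero coefficient. *)
pose bad := [set x *m U | x in predC1 (const_mx 1 : 'rV_k)].
have cF2 m : #|{: 'rV['F_2]_m}| = (2 ^ m)%N by rewrite card_mx mul1n card_Fp.
have /subsetPn[v /imsetP[y _ vE] vbad] : ~~ (good \subset bad).
  apply/negP=> /subset_leq_card; rewrite !card_imset; first last.
  - by move=> x x' /addrI; apply: row_free_inj (row_base_free _) _ _.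
  - exact: row_free_inj Ufree.
  by rewrite cardC1 !cF2 rK -subn1; have := expn_gt0 2 k; lia.
exists v; split.
  apply/dot_others; rewrite vE mulmxDl -hv0 -mulmxA.
  suff -> : K *m U^T = 0 by rewrite mulmx0 addr0.
  by apply/sub_kermxP; rewrite eq_row_base.
apply/genericP=> x w' xw' xB; have := xB.
rewrite (sum_others w) others_replace replace_same.
have [xw|xw] := F2_cases (x w).
  move=> Bx; apply: (genericP _ gB x w xw); rewrite (sum_others w) -[RHS]Bx xw !scale0r.
  by [].
rewrite xw scale1r => /eqP; rewrite addr_eq0 => /eqP vx; case/negP: vbad.
have ww' : w != w' by apply: contra_eqN xw' => /eqP <-; rewrite xw oner_eq0.
have [j w'E _] := unlift_some ww'.
apply/imsetP; exists (\row_j x (lift w j)).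
  apply/eqP=> /rowP/(_ j); rewrite !mxE -w'E xw' => /eqP.
  by rewrite eq_sym oner_eq0.
by rewrite vx; apply/eqP; rewrite eq_sym -addr_eq0 F2_addrr.
Qed.


Lemma survives_ext m B B' : B =1 B' -> survives m B -> survives m B'.
Proof.
elim: m B B' => //= m IH B B' eB hB w c; have [v hv sv] := hB w c.
exists v => [i iw|]; first by rewrite -eB hv.
by apply: IH sv => i; rewrite /replace eB.
Qed.

(** The bound on [m] encodes lexicographic progress: one more element of [Z] saves [k.+1] rounds,
    which pays for emptying [O]. The 2 extra rounds are those of [survives_rank1_absurd]. *)
Lemma survives_bounded m B (Z O : {set 'I_k.+1}) : n.+1 = (2 * k)%N ->
  survives m B -> Z :&: O = set0 -> (#|Z| + #|O| <= k)%N ->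
  (forall i j, i \in Z :|: O -> j \in Z :|: O ->
     dot (B i) (B j) = (i \in O : nat)%:R * (j \in O : nat)%:R) ->
  (2 + (k - #|Z|) * k.+1 + (k - #|Z| - #|O|) <= m)%N -> False.
Proof.
move=> nk; elim: m B Z O => [|m IH] B Z O sB disj cZO gram lem //.
have cU : #|Z :|: O| = (#|Z| + #|O|)%N by rewrite cardsU disj cards0 subn0.
have [w wZO] : exists w, w \notin Z :|: O.
  apply/existsP; rewrite -negb_forall; apply/negP=> /forallP all_in.
  suff : (k.+1 <= #|Z :|: O|)%N by rewrite cU; lia.
  rewrite -[X in (X <= _)%N](card_ord k.+1); apply/subset_leq_card/subsetP=> i _; apply: all_in.
have [full|small] := leqP k (#|Z| + #|O|).
  have ZOE : Z :|: O = [set~ w].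
    apply/eqP; rewrite eqEcard cardsC1 card_ord cU full andbT.
    by apply/subsetP=> i; rewrite !inE; apply: contraTneq => ->; rewrite -in_setU.
  apply: (@survives_rank1_absurd B w (fun i => (i \in O : nat)%:R) nk).
    by apply: survives_le sB; apply: leq_trans lem; rewrite -addnA leq_addr.
  by move=> i j iw jw; apply: gram; rewrite ZOE !inE.
have [v hv sv] := sB w (fun i => (i \in O : nat)%:R).
have [wZ wO] : w \notin Z /\ w \notin O by apply/norP; rewrite -in_setU.
have neq_w i : i \in Z :|: O -> i != w by apply: contraTneq => ->.
have [v0|v1] := F2_cases (dot v v).
- apply: (IH _ (w |: Z) set0 sv); rewrite ?setI0 ?cards0 ?cardsU1 ?wZ //; try lia.
    move=> i j; rewrite setU0 !inE mul0r => /orP iZ /orP jZ.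
    have notO a : a \in Z -> (a \in O) = false.
      move=> aZ; apply/negbTE/negP=> aO.
      by have := in_set0 a; rewrite -disj inE aZ aO.
    case: iZ jZ => [/eqP->|iZ] [/eqP->|jZ]; rewrite ?replace_same //.
    + have jU : j \in Z :|: O by rewrite inE jZ.
      by rewrite replace_other ?hv ?neq_w // notO.
    + have iU : i \in Z :|: O by rewrite inE iZ.
      by rewrite dotC replace_other ?hv ?neq_w // notO.
    + have jU : j \in Z :|: O by rewrite inE jZ.
      have iU : i \in Z :|: O by rewrite inE iZ.
      by rewrite !replace_other ?neq_w // gram // notO // mul0r.
- apply: (IH _ Z (w |: O) sv); rewrite ?cardsU1 ?wO //; try lia.
    rewrite setIUr disj setU0; apply/setP=> i; rewrite !inE.
    by case: eqP => [->|_]; rewrite ?andbF // (negbTE wZ).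
  move=> i j; rewrite setUCA !in_setU1 => /orP iU /orP jU.
  case: iU jU => [/eqP->|iU] [/eqP->|jU].
  + by rewrite replace_same eqxx v1 mulr1.
  + by rewrite replace_same replace_other ?hv ?neq_w // eqxx (negbTE (neq_w _ jU)) mul1r.
  + by rewrite dotC replace_same replace_other ?hv ?neq_w // eqxx (negbTE (neq_w _ iU)) mulr1.
  + by rewrite !replace_other ?neq_w // gram // !(negbTE (neq_w _ _)).
Qed.

End Families.

(** Start from unit vectors, of which there are enough since [k.+1 <= 2 * k], and replace them one
    by one, prescribing each time all products with the new vector. *)
Lemma generic_realizes k (t : 'I_k.+1 -> 'I_k.+1 -> 'F_2) : (0 < k)%N ->
  (forall i j, t i j = t j i) ->
  exists2 B : 'I_k.+1 -> 'rV['F_2]_(2 * k), generic B &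
    forall i j, i != j -> dot (B i) (B j) = t i j.
Proof.
move=> k_gt0 tC.
suff H m : exists2 B : 'I_k.+1 -> 'rV['F_2]_(2 * k), generic B &
    forall i j : 'I_k.+1, (i < m)%N -> (j < m)%N -> i != j -> dot (B i) (B j) = t i j.
  by have [B gB hB] := H k.+1; exists B => // i j; apply: hB.
elim: m => [|m [B gB hB]].
  have le : (k.+1 <= 2 * k)%N by lia.
  exists (fun i => delta_mx 0 (widen_ord le i)) => //.
  apply/genericP=> x w _ /rowP Bx i; have := Bx (widen_ord le i).
  rewrite summxE (bigD1 i) //= big1 ?addr0; first by rewrite !mxE !eqxx mulr1.
  move=> j ji; rewrite !mxE eqxx [widen_ord le i == _](_ : _ = (i == j)) //.
  by rewrite eq_sym (negbTE ji) mulr0.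
have [mk|km] := ltnP m k.+1; last first.
  by exists B => // i j _ _; apply: hB; apply: leq_trans km.
pose w : 'I_k.+1 := Ordinal mk.
have [v [hv gv]] := generic_extend w (t w) erefl gB.
exists (replace B w v) => // i j; rewrite !ltnS => im jm.
have lt (a : 'I_k.+1) : (a <= m)%N -> a != w -> (a < m)%N.
  by move=> am aw; rewrite ltn_neqAle am andbT.
have [->|iw] := eqVneq i w; have [->|jw] := eqVneq j w; rewrite ?eqxx //.
- by move=> _; rewrite replace_same replace_other ?hv.
- by move=> _; rewrite dotC tC replace_same replace_other ?hv.
- by move=> ij; rewrite !replace_other // hB ?lt.
Qed.

Local Close Scope ring_scope.

(** * The graph of words *)

Section Construction.
Variables k N : nat.

(* The move (i, c) replaces the vertex of colour i by a vertex whose edge to the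
   vertex of colour j is labelled c j (c i is ignored). In a word the head is the
   last move, so that the ancestors of a word are its suffixes. *)
Definition move : finType := ('I_k.+1 * {ffun 'I_k.+1 -> bool})%type.

(* The moment the current vertex of colour i was created; [::] stands for the
   initial clique. *)
Fixpoint strip (i : 'I_k.+1) (h : seq move) : seq move :=
  if h is m :: g then if m.1 == i then h else strip i g else [::].

Lemma size_strip i h : size (strip i h) <= size h.
Proof. by elim: h => //= m g IH; case: ifP => // _; apply: leqW. Qed.

Lemma stripK i h : strip i (strip i h) = strip i h.
Proof. by elim: h => //= m g IH; case: ifP => //= ->. Qed.

(** Of the last moves of colours [i] and [j], the earlier is still visible from the later. *)
Lemma strip_nested i j h :
  strip i (strip j h) = strip i h \/ strip j (strip i h) = strip j h.
Proof.
elim: h => [|m g IH] /=; first by left.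
have [mj|mj] := boolP (m.1 == j); first by left.
have [mi|//] := boolP (m.1 == i).
by right; rewrite /= (negbTE mj).
Qed.

Definition node : finType := {bseq N of move}.

Definition word_vertex : finType :=
  {x : 'I_k.+1 * node | strip x.1 x.2 == x.2 :> seq move}.

Definition color (x : word_vertex) : 'I_k.+1 := (val x).1.
Definition word (x : word_vertex) : node := (val x).2.

Lemma wordP x : strip (color x) (word x) = word x.
Proof. exact/eqP/(valP x). Qed.

Lemma vertex_eq x y : color x = color y -> word x = word y :> seq move -> x = y.
Proof.
move=> cxy wxy; apply: val_inj; move: cxy wxy; rewrite /color /word.
by case: (val x) (val y) => [i g] [j h] /= -> /val_inj ->.
Qed.

Lemma strip_insub i h : strip i (insub_bseq N (strip i h)) = insub_bseq N (strip i h).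
Proof. by rewrite /insub_bseq /insubd; case: insubP => [u _ ->|] //=; rewrite stripK. Qed.

(* The vertex of colour i current after the word h; junk (from truncation by
   insub_bseq) when strip i h is longer than N. *)
Definition vtx (i : 'I_k.+1) (h : seq move) : word_vertex :=
  exist _ (i, insub_bseq N (strip i h)) (introT eqP (strip_insub i h)).

Lemma color_vtx i h : color (vtx i h) = i. Proof. by []. Qed.

Lemma word_vtx i h : size h <= N -> word (vtx i h) = strip i h :> seq move.
Proof.
move=> hN; rewrite /word /= /insub_bseq insubdK //.
exact: leq_trans (size_strip _ _) hN.
Qed.

Lemma vtx_cons i m g : m.1 != i -> vtx i (m :: g) = vtx i g.
Proof. by move=> /negbTE mi; apply: val_inj; rewrite /= mi. Qed.

Lemma vtx_word x : vtx (color x) (word x) = x.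
Proof. by apply: vertex_eq; rewrite ?word_vtx ?wordP ?size_bseq. Qed.

(** Adjacency means different colours and that one vertex was current when the other was created. *)
Definition wedge (x y : word_vertex) : bool :=
  (color x != color y) &&
  ((word x == strip (color x) (word y) :> seq move) ||
   (word y == strip (color y) (word x) :> seq move)).

Lemma wedge_sym : symmetric wedge.
Proof. by move=> x y; rewrite /wedge eq_sym orbC. Qed.

Lemma wedge_irr : irreflexive wedge.
Proof. by move=> x; rewrite /wedge eqxx. Qed.

Definition word_graph : sgraph := SGraph wedge_sym wedge_irr.

Lemma wedge_vtx i j h : size h <= N -> i != j -> wedge (vtx i h) (vtx j h).
Proof.
move=> hN ij; rewrite /wedge !color_vtx ij !word_vtx //=.
by case: (strip_nested i j h) => ->; rewrite eqxx ?orbT.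
Qed.

(** * A tree decomposition of the word graph *)

Definition trie_edge (g h : node) : bool :=
  (h != [::] :> seq move) && (g == behead h :> seq move) ||
  (g != [::] :> seq move) && (h == behead g :> seq move).

Lemma trie_edge_sym : symmetric trie_edge.
Proof. by move=> g h; rewrite /trie_edge orbC. Qed.

Lemma trie_edge_irr : irreflexive trie_edge.
Proof.
move=> g; rewrite /trie_edge orbb; apply/negbTE; rewrite negb_and negbK.
case: (g : seq move) => //= m h; apply/eqP => /(congr1 size) /= /esym.
by elim: (size h) => // n IH [].
Qed.

Definition trie : sgraph := SGraph trie_edge_sym trie_edge_irr.

Lemma trie_edge_longest (g h : node) :
  trie_edge g h -> size g <= size h -> g = behead h :> seq move.
Proof.
case/orP=> /andP[]; first by move=> _ /eqP.
by case: (g : seq move) => //= m g' _ /eqP ->; rewrite ltnn.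
Qed.

(** Both neighbours of a longest word on a cycle would be its tail, yet they differ on a cycle of
    length at least 3. *)
Lemma trie_is_tree : is_tree trie.
Proof.
split.
- by apply/card_gt0P; exists [bseq].
- have symc : connect_sym trie_edge by apply/sym_connect_sym/trie_edge_sym.
  suff to_nil (s : seq move) (h : node) : h = s :> seq move ->
      connect trie_edge h [bseq].
    move=> g h; apply: connect_trans (to_nil _ g erefl) _.
    by rewrite symc; apply: to_nil _ h erefl.
  elim: s h => [|m s IH] h hE.
    by have -> : h = [bseq] :> node by apply: val_inj.
  have sN : size s <= N by apply: ltnW; rewrite -[_ < N]/(size (m :: s) <= N) -hE size_bseq.
  apply: connect_trans (IH (Bseq sN) erefl); apply: connect1.
  by rewrite /trie_edge hE /= eqxx orbT.
- case=> // h0 c0; set c := h0 :: c0 => c2 /andP[cyc uc].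
  have h0c : h0 \in c by rewrite mem_head.
  case: (@arg_maxnP _ h0 (fun h => h \in c) (fun h : node => size h) h0c) => h hc hmax.
  have [i s rc] := rot_to hc.
  have sub g : g \in s -> size g <= size h.
    by move=> gs; apply: hmax; have := mem_rot i c g; rewrite rc inE gs orbT => <-.
  have sz : 1 < size s by move: c2; rewrite -(size_rot i c) rc.
  move: cyc uc; rewrite -(rot_cycle i _ c) -(rot_uniq i c) rc.
  case: s sub sz {rc} => [|a [|b s]] // sub _.
  rewrite /cycle rcons_path /= => /andP[/andP[ha _] lh] /andP[_ /andP[ab _]].
  have lb : last b s \in b :: s by apply: mem_last.
  case/negP: ab; suff -> : a = last b s by [].
  apply: val_inj; rewrite /= (@trie_edge_longest a h) ?sub ?mem_head 1?trie_edge_sym //.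
  by rewrite (@trie_edge_longest (last b s) h) ?sub // inE lb orbT.
Qed.

Definition word_bag (h : trie) : {set word_graph} := [set vtx i h | i : 'I_k.+1].

Lemma mem_word_bag x (h : trie) :
  (x \in word_bag h) = (word x == strip (color x) h :> seq move).
Proof.
apply/imsetP/eqP=> [[i _ ->]|wx]; first by rewrite word_vtx ?size_bseq.
by exists (color x) => //; apply: vertex_eq; rewrite ?word_vtx ?size_bseq.
Qed.

Lemma word_bag_vertex (x : word_graph) : exists h, x \in word_bag h.
Proof. by exists (word x); rewrite mem_word_bag wordP. Qed.

Lemma word_bag_edge (x y : word_graph) : edge x y ->
  exists h, (x \in word_bag h) && (y \in word_bag h).
Proof.
case/andP=> _ /orP[] e; [exists (word y)|exists (word x)];
  by rewrite !mem_word_bag e wordP eqxx.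
Qed.

(** Deleting heads from a word where [x] is current keeps [x] current until the word of [x] is
    reached. *)
Lemma word_bag_connected (x : word_graph) (g h : trie) :
  x \in word_bag g -> x \in word_bag h ->
  connect [rel u v | [&& edge u v, x \in word_bag u & x \in word_bag v]] g h.
Proof.
set e := [rel u v | _].
have symc : connect_sym e.
  by apply: sym_connect_sym => u v; rewrite /e /= trie_edge_sym [(x \in word_bag u) && _]andbC.
suff to_word (s : seq move) (u : trie) : u = s :> seq move -> x \in word_bag u ->
    connect e u (word x).
  move=> xg xh; apply: connect_trans (to_word _ g erefl xg) _.
  by rewrite symc; apply: to_word _ h erefl xh.
elim: s u => [|m s IH] u uE xu; have := xu; rewrite mem_word_bag uE /=.
  by move/eqP=> wx; have -> : u = word x by apply: val_inj; rewrite /= uE.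
case: ifP => _ /eqP wx; first by have -> : u = word x by apply: val_inj; rewrite /= uE.
have sN : size s <= N by apply: ltnW; rewrite -[_ < N]/(size (m :: s) <= N) -uE size_bseq.
have xs : x \in word_bag (Bseq sN) by rewrite mem_word_bag wx.
apply: connect_trans (IH (Bseq sN) erefl xs); apply: connect1.
by rewrite /e /= xu xs /trie_edge uE /= eqxx orbT.
Qed.

Definition word_decomposition : tree_decomposition word_graph :=
  TreeDecomposition trie_is_tree word_bag_vertex word_bag_edge word_bag_connected.

Lemma card_word_bag h : #|word_bag h| = k.+1.
Proof.
rewrite card_imset ?card_ord // => i j /(congr1 color).
by rewrite !color_vtx.
Qed.

Lemma treewidth_word_graph : is_treewidth word_graph k.
Proof.
split=> [|D].
  exists word_decomposition; apply/eqP; rewrite eqn_leq; apply/andP; split.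
    by apply/bigmax_leqP => h _; rewrite card_word_bag.
  by rewrite -(card_word_bag [bseq]); apply: (leq_bigmax (F := fun h => #|word_bag h|)).
have [|i /subset_leq_card] := @clique_bag _ D (word_bag [bseq]).
  move=> x y; rewrite !mem_word_bag /= => /eqP wx /eqP wy xy.
  rewrite /edge /= /wedge wx wy eqxx andbT.
  by apply: contraNneq xy => cxy; apply/eqP/vertex_eq; rewrite ?wx.
rewrite card_word_bag => le; apply: leq_trans le _.
exact: (leq_bigmax (F := fun i => #|td_bag i|)).
Qed.

(** * Labels that cannot be realized in dimension 2k - 1 *)

Definition asked (x : word_vertex) (i : 'I_k.+1) : bool :=
  if word x : seq move is m :: _ then m.2 i else false.

(** The later vertex of an edge decides; adjacent vertices with words of equal length belong to the
    initial clique. *)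
Definition asked_label (x y : word_graph) : bool :=
  if size (word x) < size (word y) then asked y (color x)
  else if size (word y) < size (word x) then asked x (color y) else false.

Lemma asked_labelC x y : asked_label x y = asked_label y x.
Proof. by rewrite /asked_label; case: ltngtP. Qed.

Local Open Scope ring_scope.

(** The move [(w, c)] creates the vertex whose vector answers it; the bound [N] leaves room for [m]
    more moves. *)
Lemma realizes_survives n (U : word_graph -> 'rV['F_2]_n) m h :
  realizes asked_label U -> (size h + m <= N)%N ->
  survives m (fun i => U (vtx i h)).
Proof.
move=> hU; elim: m h => //= m IH h hm w c.
pose a : move := (w, [ffun i => c i != 0]).
have vtxE i : i != w -> vtx i (a :: h) = vtx i h.
  by move=> iw; apply: vtx_cons; rewrite eq_sym.
have sz : (size (a :: h) <= N)%N by rewrite /=; lia.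
exists (U (vtx w (a :: h))) => [i iw|].
  rewrite -vtxE // hU; last by apply: wedge_vtx; rewrite 1?eq_sym.
  rewrite [RHS]F2_eqb /asked_label /asked !color_vtx !word_vtx //= eqxx eq_sym (negbTE iw).
  by rewrite ltnNge leqW ?size_strip //= ltnS size_strip ffunE.
have surv : survives m (fun i => U (vtx i (a :: h))) by apply: IH; rewrite /=; lia.
apply: survives_ext surv => i.
 have [->|iw] := eqVneq i w; first by rewrite replace_same.
by rewrite replace_other // vtxE.
Qed.

Lemma asked_label_not_realizable n (U : word_graph -> 'rV['F_2]_n) :
  n.+1 = (2 * k)%N -> (2 + k * k.+1 + k <= N)%N -> ~ realizes asked_label U.
Proof.
move=> nk leN hU; have hs := realizes_survives (h := [::]) hU leN.
apply: (survives_bounded (Z := set0) (O := set0) nk hs);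
  rewrite ?setI0 ?cards0 ?subn0 // => i j.
by rewrite setU0 inE.
Qed.

(** * Realization of arbitrary labels in dimension 2k *)

Section Realization.
Variable lab : word_graph -> word_graph -> bool.
Hypothesis labC : forall x y, lab x y = lab y x.
Variable B0 : 'I_k.+1 -> 'rV['F_2]_(2 * k).
Hypothesis B0_generic : generic B0.
Hypothesis B0_label : forall i j, i != j ->
  dot (B0 i) (B0 j) = (lab (vtx i [::]) (vtx j [::]) : nat)%:R.

(** The default 0 can occur only when [B] is not generic. *)
Definition extension (B : 'I_k.+1 -> 'rV['F_2]_(2 * k)) w (c : 'I_k.+1 -> 'F_2) :=
  odflt 0 [pick v | [forall i, (i != w) ==> (dot v (B i) == c i)] &&
                    generic (replace B w v)].

Lemma extensionP B w c : generic B ->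
  (forall i, i != w -> dot (extension B w c) (B i) = c i) /\
  generic (replace B w (extension B w c)).
Proof.
move=> gB; rewrite /extension; case: pickP => [v /andP[/forallP hv gv]|no] /=.
  by split=> // i iw; apply/eqP; have := hv i; rewrite iw.
have [v [hv gv]] := generic_extend w c erefl gB.
have := no v; rewrite gv andbT => /negP[]; apply/forallP => i.
by apply/implyP=> iw; rewrite hv.
Qed.

Fixpoint bag_vectors (h : seq move) : 'I_k.+1 -> 'rV['F_2]_(2 * k) :=
  if h is m :: g then
    replace (bag_vectors g) m.1 (extension (bag_vectors g) m.1
      (fun i => (lab (vtx m.1 h) (vtx i g) : nat)%:R))
  else B0.

Lemma bag_vectors_generic h : generic (bag_vectors h).
Proof. by elim: h => //= m g IH; exact: (extensionP _ _ IH).2. Qed.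

(** A colour keeps its vector between moves of that colour, so a vertex has the same vector in all
    bags that contain it. *)
Lemma bag_vectors_strip i h : bag_vectors (strip i h) i = bag_vectors h i.
Proof.
elim: h => //= m g IH; have [//|mi] := boolP (m.1 == i).
by rewrite IH replace_other // eq_sym.
Qed.

Lemma bag_vectors_realize : realizes lab (fun x => bag_vectors (word x) (color x)).
Proof.
suff H (x y : word_graph) : color x != color y ->
    word x = strip (color x) (word y) :> seq move ->
    dot (bag_vectors (word y) (color y)) (bag_vectors (word x) (color x)) =
    (lab y x : nat)%:R.
  move=> x y /andP[cxy /orP[]/eqP e]; first by rewrite dotC labC; apply: H.
  by apply: H; rewrite 1?eq_sym.
move=> cxy wx; rewrite wx bag_vectors_strip.
have xE : x = vtx (color x) (word y).
  by apply: vertex_eq; rewrite ?word_vtx ?size_bseq.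
have := vtx_word y; have := wordP y.
case: (word y : seq move) xE => [|m g] xE /=.
  by move=> _ yE; rewrite B0_label 1?eq_sym // -xE yE.
case: ifP => [/eqP my _ yE|_ sE]; last first.
  by have := size_strip (color y) g; rewrite sE /= ltnn.
rewrite my replace_same replace_other //.
rewrite (extensionP _ _ (bag_vectors_generic g)).1 //.
by rewrite -(@vtx_cons (color x) m) ?my 1?eq_sym // -xE yE.
Qed.
End Realization.

Lemma label_realizable (lab : word_graph -> word_graph -> bool) :
  (0 < k)%N -> (forall x y, lab x y = lab y x) ->
  exists U : word_graph -> 'rV['F_2]_(2 * k), realizes lab U.
Proof.
move=> k_gt0 labC.
have [|B0 gB0 hB0] := @generic_realizes k
  (fun i j => (lab (vtx i [::]) (vtx j [::]) : nat)%:R) k_gt0.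
  by move=> i j; rewrite labC.
by eexists; apply: bag_vectors_realize labC _ gB0 hB0.
Qed.

End Construction.

Theorem theorem1p5 (k : nat) (hk : 0 < k) :
  exists G : sgraph, is_treewidth G k /\ is_diam (inversion_graph G) (2 * k).
Proof.
have dE : (2 * k).-1.+1 = 2 * k by rewrite prednK // muln_gt0.
(* Words must be long enough for the rounds that [survives_bounded] needs from empty [Z] and [O]. *)
exists (word_graph k (2 + k * k.+1 + k)).
split; first exact: treewidth_word_graph.
rewrite -dE; apply: diam_realizes => [lab labC|].
  by rewrite dE; apply: label_realizable.
exists (@asked_label _ _); first exact: asked_labelC.
by move=> U; apply: asked_label_not_realizable.
Qed.
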